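(* Let $d\ge 1$ be an integer, $r\ge 1$, and let $\nu,\nu',\eta\in\mathcal{W}_r(\mathbb{R}^d)$. Let $Y_1,\ldots,Y_n$ be iid random vectors with common law $\nu$, let $Y'_1,\ldots,Y'_n$ be iid random vectors with common law $\nu'$, and let $\nu_n$ and $\nu'_n$ be the empirical measures of $Y_1,\ldots,Y_n$ and of $Y'_1,\ldots,Y'_n$, respectively. Then $$W_r\big[\mathcal{L}\{W_r(\nu_n,\eta)\},\,\mathcal{L}\{W_r(\nu'_n,\eta)\}\big]\le W_r(\nu,\nu').$$
   Context: $\mathcal{W}_r(\mathbb{R}^d)$ is the set of Borel probability measures on $\mathbb{R}^d$ with finite $r$th moment. For $\mu,\nu\in\mathcal{W}_r(\mathbb{R}^d)$, $W_r(\mu,\nu)$ is the Wasserstein distance defined by $W_r(\mu,\nu)^r=\inf_{\pi\in\Pi(\mu,\nu)}\int\|x-y\|^r\,d\pi(x,y)$, where $\Pi(\mu,\nu)$ is the set of probability measures on $\mathbb{R}^d\times\mathbb{R}^d$ with first marginal $\mu$ and second marginal $\nu$. $\mathcal{L}(Z)$ denotes the law of a random variable $Z$. The symbol $W_r$ is used both on $\mathbb{R}^d$ and on $\mathbb{R}$; on the left-hand side the outer $W_r$ is the distance between laws on $\mathbb{R}$ of real random variables. The empirical measure of $Y_1,\dots,Y_n$ is $\frac1n\sum_{i=1}^n\delta_{Y_i}$. *)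

(* Defs.v *)
From HB Require Import structures.
From mathcomp Require Import all_boot all_order all_algebra.
From mathcomp Require Import all_classical all_reals all_analysis.

Set Implicit Arguments.
Unset Strict Implicit.
Unset Printing Implicit Defensive.
Import Order.TTheory GRing.Theory Num.Theory.
Import numFieldNormedType.Exports.
Local Open Scope classical_set_scope.
Local Open Scope ring_scope.

(* R^d with its Borel sigma-algebra. The topology of 'rV[R]_d is the product
   topology, i.e. the Euclidean one. *)
Notation vec R d := (g_sigma_algebraType (@open 'rV[R]_d)).

(* The library norm on 'rV[R]_d is the sup norm, hence this definition. *)
Definition eucl_norm (R : realType) (d : nat) (x : 'rV[R]_d) : R :=
  Num.sqrt (\sum_(i < d) x 0 i ^+ 2).

Section Wasserstein.
Context (R : realType) (dT : measure_display) (T : measurableType dT).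

Definition couplings (mu nu : {measure set T -> \bar R}) :
    set (probability (T * T)%type R) :=
  [set pi | forall A : set T, measurable A ->
     pushforward pi fst A = mu A /\ pushforward pi snd A = nu A].

(* Extended-real valued: the infimum is +oo when no coupling has finite cost.
   The arguments are plain measures, but since couplings are probability
   measures, couplings exist only between probability measures. *)
Definition wasserstein (dist : T -> T -> R) (r : R)
    (mu nu : {measure set T -> \bar R}) : \bar R :=
  (ereal_inf [set \int[pi]_z ((dist z.1 z.2) `^ r)%:E
             | pi in couplings mu nu] `^ r^-1)%E.

End Wasserstein.

Definition wasserstein_vec (R : realType) (d : nat) (r : R)
    (mu nu : {measure set (vec R d) -> \bar R}) : \bar R :=
  wasserstein
    (fun x y : vec R d => eucl_norm ((x : 'rV[R]_d) - (y : 'rV[R]_d))) r mu nu.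

Definition wasserstein_real (R : realType) (r : R)
    (mu nu : {measure set R -> \bar R}) : \bar R :=
  wasserstein (fun x y : R => `|x - y|) r mu nu.

Definition finite_moment (R : realType) (d : nat) (r : R)
    (mu : {measure set (vec R d) -> \bar R}) : Prop :=
  (\int[mu]_x (eucl_norm x `^ r)%:E < +oo)%E.

Section Empirical.
Context (R : realType) (dT : measure_display) (T : measurableType dT).
Context (n : nat) (y : 'I_n -> T).

Definition empirical (A : set T) : \bar R :=
  ((n%:R^-1)%:E * \sum_(i < n) \d_(y i) A)%E.

Let empirical0 : empirical set0 = 0%E.
Proof. by rewrite /empirical big1 ?mule0// => i _; rewrite measure0. Qed.

Let empirical_ge0 A : (0 <= empirical A)%E.
Proof.
by apply: mule_ge0; [rewrite lee_fin invr_ge0|apply: sume_ge0 => i _].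
Qed.

Let empirical_sigma_additive : semi_sigma_additive empirical.
Proof.
move=> F mF tF mUF; rewrite /empirical.
under eq_fun => k.
  rewrite -ge0_sume_distrr; last by move=> i _; apply: sume_ge0 => j _.
  rewrite exchange_big/=; over.
apply: cvgeZl => //.
apply: cvg_nnesum => [i _|i _]; first by apply: nearW => k; apply: sume_ge0.
exact: measure_semi_sigma_additive.
Qed.

HB.instance Definition _ := isMeasure.Build _ _ _ empirical
  empirical0 empirical_ge0 empirical_sigma_additive.

End Empirical.
Arguments empirical R {dT T n} y A.

Section IID.
Context (R : realType) (dO : measure_display) (Omega : measurableType dO).
Context (P : probability Omega R).
Context (dT : measure_display) (T : measurableType dT) (n : nat).

Definition independent_RVs (Y : 'I_n -> {RV P >-> T}) : Prop :=
  forall (J : {set 'I_n}) (A : 'I_n -> set T),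
    (forall i, i \in J -> measurable (A i)) ->
    (P (\bigcap_(i in [set` J]) (Y i @^-1` A i)) =
     \prod_(i in J) P (Y i @^-1` A i))%E.

Definition iid (Y : 'I_n -> {RV P >-> T}) (nu : {measure set T -> \bar R}) :
    Prop :=
  independent_RVs Y /\
  forall i (A : set T), measurable A -> distribution P (Y i) A = nu A.

End IID.

(* Main.v *)
(* Write F(y) = W_r(mu_y, eta), where mu_y is the empirical measure of
   y = (y_1, ..., y_n). Since mu_y is finitely supported, a coupling of mu_y and
   eta splits eta into n pieces of mass 1/n, the i-th one transported from y_i;
   sending the same pieces from y'_i instead shows that
   |F(y) - F(y')|^r <= n^-1 sum_i |y_i - y'_i|^r, without a general gluing
   lemma. Hence F is the infimum of countably many measurable functions, and
   when (Z_i, Z'_i) are iid with law a coupling pi of nu and nu', the law of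
   (F(Z), F(Z')) is a coupling of the laws of F(Y) and F(Y') whose cost is at
   most that of pi. *)
Require Import Defs.
From HB Require Import structures.
From mathcomp Require Import all_boot all_order all_algebra.
From mathcomp Require Import all_classical all_reals all_analysis.
From mathcomp Require Import measurable_realfun ring lra.
Set Implicit Arguments.
Unset Strict Implicit.
Unset Printing Implicit Defensive.
Import Order.TTheory GRing.Theory Num.Theory.
Import numFieldNormedType.Exports.
Local Open Scope classical_set_scope.
Local Open Scope ring_scope.

(** * Convexity and Minkowski-type inequalities for real powers *)

(** Convexity of the [r]-th power at [a + b = l (a / l) + (1 - l) (b / (1 - l))]. The bound is
    linear in the powers of [a] and [b], so it can be summed or integrated term by term; [l] is
    chosen only afterwards. *)
Lemma powRD_split (R : realType) (r l a b : R) : 1 <= r -> 0 < l < 1 ->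
  0 <= a -> 0 <= b ->
  (a + b) `^ r <= l `^ (1 - r) * a `^ r + (1 - l) `^ (1 - r) * b `^ r.
Proof.
move=> r1 /andP[l0 l1] a0 b0.
have m0 : 0 < 1 - l by rewrite subr_gt0.
have itv : Itv.spec (Itv.num_sem (R:=R)) (Itv.Real `[0, 1]%Z) l.
  by rewrite /= /Itv.num_sem/= num_real in_itv/= !ltW.
have : (l * (a / l) + (1 - l) * (b / (1 - l))) `^ r <=
    l * (a / l) `^ r + (1 - l) * (b / (1 - l)) `^ r.
  by apply: (convex_powR r1 (Itv.mk itv)); rewrite inE/= in_itv/= andbT
    divr_ge0 ?(ltW l0) ?(ltW m0).
have scl (c x : R) : 0 < c -> 0 <= x ->
    c * (x / c) `^ r = c `^ (1 - r) * x `^ r.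
  move=> c0 x0; rewrite powRM ?invr_ge0 ?(ltW c0)// -powR_inv1 ?(ltW c0)//.
  rewrite -powRrM mulN1r powRD ?(gt_eqF c0) ?implybT//.
  by rewrite powRr1 ?(ltW c0)// mulrCA mulrC.
have cancelc (c x : R) : 0 < c -> c * (x / c) = x.
  by move=> c0; rewrite mulrCA divff ?mulr1 ?gt_eqF.
by rewrite !scl// !cancelc.
Qed.

(* Taking l = A^(1/r) / (A^(1/r) + B^(1/r)) turns the family of bounds on C into
   (A^(1/r) + B^(1/r))^r; adding e/2 to both roots covers A = 0 and B = 0. *)
Lemma powR_minkowski_split (R : realType) (r A B C : R) : 1 <= r ->
  0 <= A -> 0 <= B -> 0 <= C ->
  (forall l, 0 < l < 1 -> C <= l `^ (1 - r) * A + (1 - l) `^ (1 - r) * B) ->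
  C `^ r^-1 <= A `^ r^-1 + B `^ r^-1.
Proof.
move=> r1 A0 B0 C0 H.
have r0 : 0 < r by exact: lt_le_trans r1.
apply/ler_addgt0Pr => e e0.
set a := A `^ r^-1 + e / 2; set b := B `^ r^-1 + e / 2.
have a0 : 0 < a by rewrite ltr_wpDl ?powR_ge0 ?divr_gt0.
have b0 : 0 < b by rewrite ltr_wpDl ?powR_ge0 ?divr_gt0.
have ab0 : 0 < a + b by rewrite addr_gt0.
have -> : A `^ r^-1 + B `^ r^-1 + e = a + b by rewrite /a /b; lra.
have root (x : R) : 0 <= x -> x = (x `^ r^-1) `^ r.
  by move=> x0; rewrite -powRrM mulVf ?gt_eqF// powRr1.
have lep (x y : R) : 0 <= x -> y = x `^ r^-1 + e / 2 -> x <= y `^ r.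
  move=> x0 ->; rewrite [leLHS](root x x0).
  apply: ge0_ler_powR; rewrite ?nnegrE ?addr_ge0 ?powR_ge0 ?(ltW r0)//.
    by rewrite ltW// divr_gt0.
  by rewrite lerDl ltW// divr_gt0.
have leA : A <= a `^ r by exact: lep.
have leB : B <= b `^ r by exact: lep.
clearbody a b.
have scl (c : R) : 0 < c ->
    (c / (a + b)) `^ (1 - r) * c `^ r = (a + b) `^ (r - 1) * c.
  move=> c0; rewrite powRM ?invr_ge0 ?ltW// mulrAC.
  rewrite -powRD ?(gt_eqF c0) ?implybT//.
  rewrite subrK powRr1 ?ltW// -powR_inv1 ?ltW// -powRrM.
  by rewrite mulN1r opprB mulrC.
have sum1 : 1 - a / (a + b) = b / (a + b) by field; rewrite gt_eqF.
have lab : 0 < a / (a + b) < 1.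
  by rewrite divr_gt0//= ltr_pdivrMr// mul1r ltrDl.
have : C <= (a + b) `^ r.
  apply: (le_trans (H _ lab)); rewrite sum1.
  apply: (@le_trans _ _ ((a / (a + b)) `^ (1 - r) * a `^ r +
                         (b / (a + b)) `^ (1 - r) * b `^ r)).
    by rewrite lerD// ler_wpM2l ?powR_ge0 ?leA ?leB.
  rewrite (scl a a0) (scl b b0) -mulrDr -{2}[a + b]powRr1 ?(ltW ab0)//.
  by rewrite -powRD ?(gt_eqF ab0) ?implybT ?subrK.
move=> /(ge0_ler_powR (ltW (_ : 0 < r^-1))).
rewrite invr_gt0 !nnegrE powR_ge0 => /(_ r0 C0 isT).
by rewrite -powRrM divff ?gt_eqF// powRr1// ltW.
Qed.

(** * Image, sum, restriction and normalisation of measures *)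

(** The measure structure of an image depends on the proof of measurability of [f]. The existential
    form hides it and keeps only the values on sets and the integrals of nonnegative functions. *)
Lemma pushforward_spec (R : realType) d1 d2 (T1 : measurableType d1)
    (T2 : measurableType d2) (m : {measure set T1 -> \bar R}) (f : T1 -> T2) :
  measurable_fun setT f ->
  exists m' : {measure set T2 -> \bar R},
    (forall A, m' A = m (f @^-1` A)) /\
    forall h : T2 -> \bar R, (forall x, (0 <= h x)%E) -> measurable_fun setT h ->
      (\int[m']_x h x = \int[m]_x h (f x))%E.
Proof.
move=> mf.
unshelve eexists (pushforward m f : {measure set T2 -> \bar R}); first exact: mf.
split => // h h0 mh; rewrite ge0_integral_pushforward//.
Qed.

Lemma sum_measure_spec (R : realType) d (T : measurableType d) n
    (m : 'I_n -> {measure set T -> \bar R}) :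
  exists m' : {measure set T -> \bar R},
    (forall A, m' A = \sum_(i < n) m i A)%E /\
    forall h : T -> \bar R, (forall x, (0 <= h x)%E) -> measurable_fun setT h ->
      (\int[m']_x h x = \sum_(i < n) \int[m i]_x h x)%E.
Proof.
(* [msum] adds the first terms of a sequence indexed by [nat], so the family is extended by the zero
   measure. *)
pose M k : {measure set T -> \bar R} := if insub k is Some i then m i else mzero.
have ME (i : 'I_n) : M i = m i by rewrite /M valK.
exists (msum M n); split=> [A|h h0 mh].
  by rewrite /= /msum; apply: eq_bigr => i _; rewrite ME.
by rewrite ge0_integral_measure_sum//; apply: eq_bigr => i _; rewrite ME.
Qed.

Lemma restrict_scale_spec (R : realType) d (T : measurableType d)
    (m : {measure set T -> \bar R}) (k : {nonneg R}) (D : set T) :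
  measurable D ->
  exists m' : {measure set T -> \bar R},
    (forall A, m' A = k%:num%:E * m (A `&` D))%E /\
    forall h : T -> \bar R, (forall x, (0 <= h x)%E) -> measurable_fun setT h ->
      (\int[m']_x h x = k%:num%:E * \int[m]_(x in D) h x)%E.
Proof.
move=> mD; exists (mscale k (mrestr m mD)); split=> // h h0 mh.
rewrite ge0_integral_mscale//; congr (_ * _)%E.
(* The complement of [D] is null for the restricted measure, and on measurable subsets of [D] this
   measure agrees with [m]. *)
rewrite (ge0_negligible_integral (N := ~` D))//=.
- by rewrite setTD setCK; apply: eq_measure_integral => A mA /setIidl AD;
    rewrite /= /mrestr AD.
- exact: measurableC.
- by rewrite /mrestr setICl measure0.
Qed.
Lemma probability_of_measure (R : realType) d (T : measurableType d)
    (m : {measure set T -> \bar R}) :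
  m setT = 1%E -> exists p : probability T R, forall A, p A = m A.
Proof.
(* The Dirac mass is the default for total mass 0 or infinity, which [m1] excludes; the
   normalisation then divides by 1. *)
move=> m1; exists (mnormalize m \d_point) => A.
by rewrite /= /mnormalize m1 onee_eq0/= invr1 mule1.
Qed.

(** * Couplings of an empirical measure as families of pieces *)

Section EmpiricalCoupling.
Context (R : realType) (dT : measure_display) (T : measurableType dT) (n : nat).
Implicit Types (y : 'I_n -> T) (eta : {measure set T -> \bar R}).

Lemma empiricalE y (A : set T) :
  (empirical R y : {measure set T -> \bar R}) A =
  (n%:R^-1 * \sum_(i < n) (y i \in A)%:R)%:E.
Proof.
by rewrite /= /empirical EFinM -sumEFin.
Qed.

(** The coupling is the sum over [i] of the product of the Dirac mass at [y i] with [e i], built as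
    the image of [e i] under [z |-> (y i, z)]. The conditions on the pieces do not involve [y], so
    the same pieces serve any other tuple. *)
Lemma coupling_of_pieces y eta (e : 'I_n -> {measure set T -> \bar R}) :
  (0 < n)%N -> (forall i, e i setT = (n%:R^-1)%:E) ->
  (forall A, measurable A -> (\sum_(i < n) e i A = eta A)%E) ->
  exists2 pi : probability (T * T)%type R, couplings (empirical R y) eta pi &
    forall h : T * T -> \bar R,
      (forall x, (0 <= h x)%E) -> measurable_fun setT h ->
      (\int[pi]_x h x = \sum_(i < n) \int[e i]_z h (y i, z))%E.
Proof.
move=> n0 emass esum.
have mpair i : measurable_fun setT (fun z : T => (y i, z)).
  exact: measurable_fun_pair.
have [p pE] := choice (fun i => pushforward_spec (e i) (mpair i)).
have [m [mE mint]] := sum_measure_spec p.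
have m1 : m setT = 1%E.
  rewrite mE (eq_bigr (fun=> (n%:R^-1)%:E)); last first.
    by move=> i _; rewrite (pE i).1 preimage_setT emass.
  rewrite sumEFin sumr_const card_ord -[_ *+ n]mulr_natl mulfV//.
  by rewrite pnatr_eq0 -lt0n.
have [pi piE] := probability_of_measure m1.
exists pi => [A mA|h h0 mh]; last first.
  rewrite (eq_measure_integral m) ?mint//; last by move=> A _ _; exact: piE.
  by apply: eq_bigr => i _; rewrite (pE i).2.
rewrite /pushforward !piE !mE; split; last first.
  by rewrite -esum//; apply: eq_bigr => i _; rewrite (pE i).1.
rewrite empiricalE mulr_sumr -sumEFin; apply: eq_bigr => i _.
(* The set of [z] with [y i] in [A] is the whole space or empty. *)
rewrite (pE i).1; case: (boolP (y i \in A)) => yA.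
  rewrite mulr1 -(emass i); congr (e i _); apply/seteqP; split=> // z _.
  exact: set_mem.
rewrite mulr0; apply: etrans (measure0 (e i)); congr (e i _).
apply/seteqP; split=> // z /= Az.
by move/negP: yA; apply; exact: mem_set.
Qed.

(** Converse of [coupling_of_pieces]: a disintegration of [pi] along its first marginal. It is
    elementary because this marginal has finitely many atoms: restrict [pi] to the fibre over [y i],
    rescale, and project to the second component. *)
Lemma pieces_of_coupling y eta (pi : probability (T * T)%type R) :
  (forall x : T, measurable [set x]) -> couplings (empirical R y) eta pi ->
  exists e : 'I_n -> {measure set T -> \bar R},
    [/\ forall i, e i setT = (n%:R^-1)%:E,
        forall A, measurable A -> (\sum_(i < n) e i A = eta A)%E &
        forall h : T * T -> \bar R,
          (forall x, (0 <= h x)%E) -> measurable_fun setT h ->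
          (\sum_(i < n) \int[e i]_z h (y i, z) = \int[pi]_x h x)%E].
Proof.
move=> mset1 cpi.
(* The points y i need not be distinct: the mass at a point x is shared equally
   among the mult x indices i with y i = x. *)
pose mult x : nat := (\sum_(j < n) (y j == x))%N.
have k0 x : 0 <= (mult x)%:R^-1 :> R by rewrite invr_ge0 ler0n.
pose k x : {nonneg R} := NngNum (k0 x).
pose D i : set (T * T) := fst @^-1` [set y i].
have mD i : measurable (D i) by rewrite -[D i]setTI; exact: measurable_fst.
have mult0 i : (mult (y i))%:R != 0 :> R.
  by rewrite pnatr_eq0 -lt0n /mult (bigD1 i)//= addn_gt0 eqxx.
have empset x : (empirical R y : {measure set T -> \bar R}) [set x] =
    (n%:R^-1 * (mult x)%:R)%:E.
  rewrite empiricalE natr_sum; congr (_ * _)%:E.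
  apply: eq_bigr => i _; rewrite (_ : (y i \in [set x]) = (y i == x))//.
  by apply/idP/eqP => [/set_mem|/mem_set].
(* The rescaled restrictions of [pi] to the fibres add up to [pi]. Outside the fibres over the
   finite set [V] there is no mass, by the first marginal. *)
have ksum (h : T * T -> \bar R) : (forall x, (0 <= h x)%E) ->
    measurable_fun setT h ->
    (\sum_(i < n) (k (y i))%:num%:E * \int[pi]_(x in D i) h x =
     \int[pi]_x h x)%E.
  move=> h0 mh; pose V := \bigcup_(i in [set: 'I_n]) [set y i].
  have mV : measurable V by exact: fin_bigcup_measurable.
  pose N : set (T * T) := fst @^-1` (~` V).
  have mN : measurable N.
    by rewrite -[N]setTI; apply: measurable_fst => //; exact: measurableC.
  have N0 : pi N = 0%E.
    have [piV _] := cpi _ (measurableC mV).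
    rewrite -[LHS]/(pushforward pi fst (~` V)) piV empiricalE big1 ?mulr0//.
    move=> i _; by rewrite memNset//=; apply; exists i.
  rewrite [RHS](ge0_negligible_integral mN)//= setTD integral_mkcond.
  transitivity (\int[pi]_x \sum_(i < n) ((k (y i))%:num%:E * (h \_ (D i)) x))%E.
    have mhD i : measurable_fun setT (h \_ (D i)).
      by apply/(measurable_restrictT _ _).1 => //; exact: measurable_funTS.
    have hD0 i x : (0 <= (h \_ (D i)) x)%E by exact: erestrict_ge0.
    rewrite ge0_integral_sum//; last 2 first.
    - by move=> i; exact: measurable_funeM.
    - by move=> i x _; exact: mule_ge0.
    by apply: eq_bigr => i _; rewrite ge0_integralZl// -integral_mkcond.
  apply: eq_integral => x _.
  have [[j _ xj]|xV] := pselect (V x.1); last first.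
    have xN : ~ (~` N) x by move=> /(_ xV).
    rewrite [RHS]patchE (memNset xN) big1// => i _.
    rewrite patchE memNset ?mule0// => xi.
    by apply: xV; exists i.
  rewrite [RHS]patchE mem_set; last by rewrite /N/= => xN; apply: xN; exists j.
  (* Over a point [x.1] of [V], exactly [mult x.1] indices contribute, each with weight
     [1 / mult x.1], so the weights add up to 1. *)
  rewrite (eq_bigr (fun i => ((y i == x.1)%:R / (mult x.1)%:R)%:E * h x)%E).
    rewrite -ge0_sume_distrl; last by move=> i _; rewrite lee_fin divr_ge0.
    rewrite sumEFin -mulr_suml -natr_sum divff ?mul1e// xj; exact: mult0.
  move=> i _; rewrite patchE /D /=; case: eqP => [xi|/eqP xi].
    by rewrite mem_set//= xi mul1r.
  by rewrite memNset/= ?mul0r ?mul0e ?mule0// => /eqP; rewrite eq_sym (negPf xi).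
have piece i : exists e : {measure set T -> \bar R},
    (forall A, e A = (k (y i))%:num%:E * pi (snd @^-1` A `&` D i))%E /\
    forall h : T -> \bar R, (forall z, (0 <= h z)%E) -> measurable_fun setT h ->
      (\int[e]_z h z = (k (y i))%:num%:E * \int[pi]_(x in D i) h x.2)%E.
  have [m [mE mint]] := restrict_scale_spec pi (k (y i)) (mD i).
  have [e [eE eint]] := pushforward_spec m (@measurable_snd _ _ T T).
  exists e; split=> [A|h h0 mh]; first by rewrite eE mE.
  by rewrite eint// mint//; exact: measurableT_comp.
have [e eE] := choice piece; exists e; split.
- move=> i; rewrite (eE i).1 preimage_setT setTI.
  have [piy _] := cpi _ (mset1 (y i)).
  rewrite -[pi (D i)]/(pushforward pi fst [set y i]) piy empset -EFinM /=.
  by rewrite mulrCA mulVf ?mulr1.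
- move=> A mA; have [_ <-] := cpi _ mA.
  have mA2 : measurable (snd @^-1` A : set (T * T)).
    by rewrite -[X in measurable X]setTI; exact: measurable_snd.
  have piA : (\int[pi]_x (\1_(snd @^-1` A) x)%:E = pi (snd @^-1` A))%E.
    by rewrite integral_indic// setIT.
  rewrite /pushforward -piA -ksum//.
  + by apply: eq_bigr => i _; rewrite (eE i).1 integral_indic.
  + exact/measurable_EFinP/measurable_indic.
- move=> h h0 mh; rewrite -ksum//; apply: eq_bigr => i _.
  rewrite (eE i).2//; last exact: measurableT_comp mh _.
  by congr (_ * _)%E; apply: eq_integral => -[a b] /set_mem; rewrite /D /= => ->.
Qed.

End EmpiricalCoupling.

(** * Lipschitz dependence of the empirical distance on the sample *)

Section EmpiricalWasserstein.
Context (R : realType) (dT : measure_display) (T : measurableType dT).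
Context (dist : T -> T -> R).
Context (dist_ge0 : forall x y, 0 <= dist x y).
Context (dist_eq0 : forall x y, dist x y = 0 <-> x = y).
Context (distC : forall x y, dist x y = dist y x).
Context (dist_triangle : forall x y z, dist x z <= dist x y + dist y z).
Context (dist_measurable : measurable_fun setT (fun z : T * T => dist z.1 z.2)).
Context (r : R) (r1 : 1 <= r) (n : nat) (n0 : (0 < n)%N).
Context (eta : probability T R).
Context (eta_moment : forall x, (\int[eta]_z (dist x z `^ r)%:E < +oo)%E).
Implicit Types y : 'I_n -> T.

Let r0 : 0 < r. Proof. exact: lt_le_trans r1. Qed.

Let dist_measurable_l x : measurable_fun setT (dist x).
Proof.
exact: (measurableT_comp dist_measurable (measurable_fun_pair _ _)).
Qed.

Let measurable_set1 (x : T) : measurable [set x].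
Proof.
rewrite (_ : [set x] = setT `&` dist x @^-1` [set 0]).
  exact: dist_measurable_l.
by rewrite setTI; apply/seteqP; split=> z /=; rewrite dist_eq0 => ->.
Qed.

Let cost_measurable x : measurable_fun setT (fun z => (dist x z `^ r)%:E).
Proof.
apply/measurable_EFinP.
exact: (measurableT_comp (measurable_powR r) (dist_measurable_l x)).
Qed.

Let cost2_measurable :
  measurable_fun setT (fun z : T * T => (dist z.1 z.2 `^ r)%:E).
Proof.
by apply/measurable_EFinP; exact: (measurableT_comp (measurable_powR r)).
Qed.

Let cost_ge0 x z : (0 <= (dist x z `^ r)%:E)%E.
Proof. by rewrite lee_fin powR_ge0. Qed.

Let cost2_ge0 (z : T * T) : (0 <= (dist z.1 z.2 `^ r)%:E)%E.
Proof. exact: cost_ge0. Qed.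

(** This is the cost of the coupling that matches the points of two empirical measures index by
    index. *)
Definition mean_cost y y' : R := n%:R^-1 * \sum_(i < n) dist (y i) (y' i) `^ r.

Lemma mean_cost_ge0 y y' : 0 <= mean_cost y y'.
Proof. by rewrite mulr_ge0 ?invr_ge0// sumr_ge0// => i _; exact: powR_ge0. Qed.

Definition optimal_cost y : \bar R :=
  ereal_inf [set \int[pi]_z ((dist z.1 z.2) `^ r)%:E
            | pi in couplings (empirical R y) eta]%E.

Lemma optimal_cost_ge0 y : (0 <= optimal_cost y)%E.
Proof.
apply: le_ereal_inf_tmp => _ [pi _ <-]; apply: integral_ge0 => x _.
by rewrite lee_fin powR_ge0.
Qed.

(** Taking every piece equal to [eta / n] gives the product coupling, whose cost is finite by
    [eta_moment]. *)
Lemma optimal_cost_fin_num y : optimal_cost y \is a fin_num.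
Proof.
rewrite ge0_fin_numE ?optimal_cost_ge0//.
have ninv0 : 0 <= n%:R^-1 :> R by rewrite invr_ge0.
pose k : {nonneg R} := NngNum ninv0.
have [|i|A mA|pi cpi piE] :=
  @coupling_of_pieces R dT T n y eta (fun=> mscale k eta).
- exact: n0.
- by rewrite /= /mscale/= probability_setT mule1.
- rewrite /= /mscale/= -ge0_sume_distrl// sumEFin sumr_const card_ord.
  by rewrite -[_ *+ n]mulr_natl mulfV ?mul1e// pnatr_eq0 -lt0n.
apply: le_lt_trans; first by apply: ereal_inf_lbound; exists pi.
rewrite piE//; apply: lte_sum_pinfty => i _ /=.
rewrite ge0_integral_mscale//.
by rewrite lte_mul_pinfty// lee_fin.
Qed.

(** Any coupling for [y] is cut into pieces, which are sent from [y'] instead; the triangle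
    inequality and [powRD_split] bound the new cost under each integral. *)
Lemma optimal_cost_le y y' l : 0 < l < 1 ->
  fine (optimal_cost y') <= l `^ (1 - r) * fine (optimal_cost y) +
                            (1 - l) `^ (1 - r) * mean_cost y y'.
Proof.
move=> l01; have /andP[l0 l1] := l01.
set a := l `^ (1 - r); set b := (1 - l) `^ (1 - r).
have a0 : 0 < a by exact: powR_gt0.
have b0 : 0 <= b by exact: powR_ge0.
rewrite -lee_fin EFinD EFinM !fineK ?optimal_cost_fin_num//.
(* Isolating the infimum for [y] reduces the claim to an arbitrary coupling for [y], with no
   minimiser needed. *)
rewrite -leeBlDr// -lee_pdivrMl//; apply: le_ereal_inf_tmp => _ [pi cpi <-].
rewrite lee_pdivrMl// leeBlDr//.
have [e [emass esum eint]] := pieces_of_coupling measurable_set1 cpi.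
have [pi' cpi' pi'int] := coupling_of_pieces y' n0 emass esum.
apply: le_trans; first by apply: ereal_inf_lbound; exists pi'.
rewrite pi'int// -eint//.
have int_ge0 i x : (0 <= \int[e i]_z (dist x z `^ r)%:E)%E.
  by apply: integral_ge0 => z _; rewrite lee_fin powR_ge0.
apply: (@le_trans _ _ (\sum_(i < n) (a%:E * \int[e i]_z (dist (y i) z `^ r)%:E +
    (b * dist (y i) (y' i) `^ r * n%:R^-1)%:E)))%E.
  apply: lee_sum => i _.
  (* As [e i] has mass [1 / n], the constant term is the integral of a constant against [e i], and
     the two sides can be compared pointwise. *)
  rewrite [X in (_ + X)%E]EFinM -(emass i) -integral_cst//.
  rewrite -ge0_integralZl_EFin//; last exact: ltW.
  rewrite -ge0_integralD//.
  - apply: ge0_le_integral => //.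
    + exact: cost_measurable.
    + apply: emeasurable_funD => //; exact: measurable_funeM.
    + move=> z _; rewrite -EFinM -EFinD lee_fin.
      apply: le_trans (powRD_split r1 l01 _ _) => //.
      apply: ge0_ler_powR; rewrite ?nnegrE ?addr_ge0 ?(ltW r0)//.
      by rewrite addrC (distC (y i)).
  - by move=> z _; rewrite mule_ge0// lee_fin ?powR_ge0// ltW.
  - exact: measurable_funeM.
  - by move=> z _; rewrite lee_fin mulr_ge0// powR_ge0.
rewrite big_split/= -ge0_sume_distrr// leeD2l//.
rewrite sumEFin lee_fin /mean_cost mulrCA mulr_sumr mulr_sumr.
by rewrite ler_sum// => i _; rewrite mulrC.
Qed.

(** [fine] would turn an infinite value into 0; [EFin_empirical_wasserstein] rules this out. *)
Definition empirical_wasserstein y : R :=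
  fine (wasserstein dist r (empirical R y) eta).

Lemma empirical_wassersteinE y :
  empirical_wasserstein y = fine (optimal_cost y) `^ r^-1.
Proof. by rewrite /empirical_wasserstein /wasserstein fine_poweR. Qed.

Lemma EFin_empirical_wasserstein y :
  (empirical_wasserstein y)%:E = wasserstein dist r (empirical R y) eta.
Proof.
by rewrite fineK// /wasserstein fin_num_poweR// optimal_cost_fin_num.
Qed.

(** [optimal_cost_le] holds for every [l], which is the family of bounds that [powR_minkowski_split]
    turns into a bound between roots. *)
Lemma empirical_wasserstein_le y y' :
  empirical_wasserstein y' <= empirical_wasserstein y + mean_cost y y' `^ r^-1.
Proof.
rewrite !empirical_wassersteinE; apply: powR_minkowski_split => //.
- by rewrite fine_ge0// optimal_cost_ge0.
- exact: mean_cost_ge0.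
- by rewrite fine_ge0// optimal_cost_ge0.
- by move=> l; exact: optimal_cost_le.
Qed.

Lemma mean_costC y y' : mean_cost y y' = mean_cost y' y.
Proof. by congr (_ * _); apply: eq_bigr => i _; rewrite distC. Qed.

Lemma empirical_wasserstein_dist_le y y' :
  `|empirical_wasserstein y - empirical_wasserstein y'| `^ r <= mean_cost y y'.
Proof.
rewrite -[leRHS]powRr1 ?mean_cost_ge0// -(@mulVf _ r) ?gt_eqF// powRrM.
apply: ge0_ler_powR; rewrite ?nnegrE ?powR_ge0 ?(ltW r0)//.
rewrite ler_norml lerBlDl lerNl opprB lerBlDl empirical_wasserstein_le.
by rewrite mean_costC empirical_wasserstein_le.
Qed.

End EmpiricalWasserstein.

(** * The product sigma-algebra on tuples, and joint laws *)

(** Measurable rectangles generate the product sigma-algebra of [fun_space T n]; tuples stay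
    functions on ['I_n], the form that [empirical] takes. *)
Definition boxes (dT : measure_display) (T : measurableType dT) (n : nat) :
    set (set ('I_n -> T)) :=
  [set B | exists2 A : 'I_n -> set T,
    forall i, measurable (A i) & B = [set y | forall i, A i (y i)]].
Arguments boxes {dT} T n.

Notation fun_space T n := (g_sigma_algebraType (boxes T n)).

Section Boxes.
Context (dT : measure_display) (T : measurableType dT) (n : nat).

Lemma measurable_fun_to_boxes dO (Omega : measurableType dO)
    (Y : 'I_n -> Omega -> T) :
  (forall i, measurable_fun setT (Y i)) ->
  measurable_fun setT ((fun w i => Y i w) : Omega -> fun_space T n).
Proof.
move=> mY; apply: (@measurability _ _ _ (fun_space T n) _ _ (boxes T n)) => //.
move=> _ [_ [A mA ->] <-].
rewrite (_ : _ `&` _ = \bigcap_(i in [set: 'I_n]) (Y i @^-1` A i)).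
  apply: fin_bigcap_measurable => // i _.
  by rewrite -[X in measurable X]setTI; exact: mY.
by rewrite setTI; apply/seteqP; split=> w wA i; [move=> _|]; exact: wA.
Qed.

Lemma measurable_coordinate i :
  measurable_fun setT ((fun y => y i) : fun_space T n -> T).
Proof.
move=> _ A mA; rewrite setTI; apply: sub_sigma_algebra.
exists (fun j => if j == i then A else setT).
  by move=> j; case: ifP.
apply/seteqP; split=> y /=; first by move=> yA j; case: eqP => // ->.
by move=> /(_ i); rewrite eqxx.
Qed.

Lemma setI_closed_boxes : setI_closed (boxes T n).
Proof.
move=> _ _ [A mA ->] [B mB ->]; exists (fun i => A i `&` B i).
  by move=> i; exact: measurableI.
apply/seteqP; split=> y /=; first by case=> yA yB i; split.
by move=> yAB; split=> i; have [] := yAB i.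
Qed.

(** Uniqueness of finite measures on a generating pi-system: both joint laws give boxes the same
    product of values of [nu]. *)
Lemma joint_law_unique (R : realType) (nu : set T -> \bar R)
    dO (Omega : measurableType dO) (P : probability Omega R)
    dO' (Omega' : measurableType dO') (P' : probability Omega' R)
    (Y : 'I_n -> Omega -> T) (Y' : 'I_n -> Omega' -> T) :
  (forall i, measurable_fun setT (Y i)) ->
  (forall i, measurable_fun setT (Y' i)) ->
  (forall A : 'I_n -> set T, (forall i, measurable (A i)) ->
    P [set w | forall i, A i (Y i w)] = (\prod_(i < n) nu (A i))%E) ->
  (forall A : 'I_n -> set T, (forall i, measurable (A i)) ->
    P' [set w | forall i, A i (Y' i w)] = (\prod_(i < n) nu (A i))%E) ->
  forall E : set (fun_space T n), measurable E ->
    P [set w | E (fun i => Y i w)] = P' [set w | E (fun i => Y' i w)].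
Proof.
move=> mY mY' PY PY' E mE.
have [m [mE1 _]] := pushforward_spec P (measurable_fun_to_boxes mY).
have [m' [mE1' _]] := pushforward_spec P' (measurable_fun_to_boxes mY').
rewrite -[LHS]mE1 -[RHS]mE1'.
apply: (@measure_unique _ _ (fun_space T n) (boxes T n) (fun=> setT)) => //.
- exact: setI_closed_boxes.
- by move=> _; exists (fun=> setT) => //; apply/seteqP; split.
- by rewrite bigcup_const//; exists 0%N.
- move=> _ [A mA ->]; rewrite mE1 mE1'.
  exact: etrans (PY A mA) (esym (PY' A mA)).
- move=> _; rewrite mE1.
  exact: le_lt_trans (probability_le1 P measurableT) (ltry 1).
Qed.

End Boxes.

(** * Existence of finite iid families *)

(** Induction on [n], adding one factor [pi] by a binary product measure. Indexing by [nat] keeps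
    the type of [Z] independent of [n]; only the indices below [n] are constrained. *)
Lemma iid_sequence_exists (R : realType) (dT : measure_display)
    (T : measurableType dT) (pi : probability T R) (n : nat) :
  exists dO (Omega : measurableType dO) (Q : probability Omega R)
      (Z : nat -> Omega -> T),
    (forall k, measurable_fun setT (Z k)) /\
    forall A : nat -> set T, (forall k, measurable (A k)) ->
      Q [set w | forall k, (k < n)%N -> A k (Z k w)] =
      (\prod_(k < n) pi (A k))%E.
Proof.
elim: n => [|n [dO [Om [Q [Z [mZ QZ]]]]]].
  (* For [n = 0] any probability space would do: the event is the whole space and the product is
     empty. *)
  exists dT, T, pi, (fun _ x => x); split=> // A mA.
  rewrite big_ord0 -(probability_setT pi); congr (pi _).
  by apply/seteqP; split.
exists _, (Om * T)%type, (Q \x pi)%E.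
(* The new variable, of index [n], reads the second factor; earlier ones read the first. *)
exists (fun k w => if (k < n)%N then Z k w.1 else w.2); split=> [k|A mA].
  case: (k < n)%N; last exact: measurable_snd.
  exact: measurableT_comp (mZ k) measurable_fst.
rewrite big_ord_recr/= -QZ//.
rewrite -product_measure1E//.
  congr ((Q \x pi)%E _); apply/seteqP; split=> -[w t]/=.
    move=> H; split; last by have := H n (ltnSn n); rewrite ltnn.
    by move=> k kn; have := H k (ltnW kn); rewrite kn.
  move=> [H At] k; rewrite ltnS leq_eqVlt => /predU1P[->|kn].
    by rewrite ltnn.
  by rewrite kn; exact: H.
rewrite (_ : [set _ | _] = \bigcap_(k in `I_n) (Z k @^-1` A k))//.
apply: fin_bigcap_measurable => [|k _]; first exact: finite_II.
by rewrite -[X in measurable X]setTI; exact: mZ.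
Qed.

Lemma iid_family_exists (R : realType) (dT : measure_display)
    (T : measurableType dT) (pi : probability T R) (n : nat) :
  exists dO (Omega : measurableType dO) (Q : probability Omega R)
      (Z : 'I_n -> Omega -> T),
    (forall i, measurable_fun setT (Z i)) /\
    forall A : 'I_n -> set T, (forall i, measurable (A i)) ->
      Q [set w | forall i, A i (Z i w)] = (\prod_(i < n) pi (A i))%E.
Proof.
have [dO [Om [Q [Z [mZ QZ]]]]] := iid_sequence_exists pi n.
exists dO, Om, Q, (fun i => Z i); split=> // A mA.
pose B k := if insub k is Some i then A i else setT.
have BE (i : 'I_n) : B i = A i by rewrite /B valK.
rewrite (eq_bigr (fun i : 'I_n => pi (B i))); last by move=> i _; rewrite BE.
rewrite -QZ => [|k]; last by rewrite /B; case: insubP.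
congr (Q _); apply/seteqP; split=> w wA i.
  by move=> ilt; have := wA (Ordinal ilt); rewrite -BE.
by rewrite -BE; exact: wA.
Qed.

Lemma iid_box (R : realType) dO (Omega : measurableType dO)
    (P : probability Omega R) (dT : measure_display) (T : measurableType dT)
    (n : nat) (Y : 'I_n -> {RV P >-> T}) (nu : {measure set T -> \bar R})
    (A : 'I_n -> set T) : iid Y nu -> (forall i, measurable (A i)) ->
  P [set w | forall i, A i (Y i w)] = (\prod_(i < n) nu (A i))%E.
Proof.
move=> [indep law] mA.
have := indep [set: 'I_n]%SET A (fun i _ => mA i).
rewrite (eq_bigl xpredT) => [PE|i]; last by rewrite finset.in_setT.
rewrite (eq_bigr (fun i => P (Y i @^-1` A i))) => [|i _]; last exact/esym/law.
rewrite -PE; congr (P _); apply/seteqP; split=> w wA i.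
  by move=> _; exact: wA.
by apply: wA; rewrite /= finset.in_setT.
Qed.

Lemma RV_of_measurable (R : realType) d d' (T : measurableType d)
    (T' : measurableType d') (P : probability T R) (f : T -> T') :
  measurable_fun setT f -> exists X : {RV P >-> T'}, X = f :> (T -> T').
Proof.
move=> mf; pose mixin := isMeasurableFun.Build _ _ _ _ f mf.
by exists (HB.pack f mixin : {mfun T >-> T'}).
Qed.

(** * The inequality on a separable metric space *)

Section SeparableMetric.
Context (R : realType) (dT : measure_display) (T : measurableType dT).
Context (dist : T -> T -> R).
Context (dist_ge0 : forall x y, 0 <= dist x y).
Context (dist_eq0 : forall x y, dist x y = 0 <-> x = y).
Context (distC : forall x y, dist x y = dist y x).
Context (dist_triangle : forall x y z, dist x z <= dist x y + dist y z).
Context (dist_measurable : measurable_fun setT (fun z : T * T => dist z.1 z.2)).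
Context (I : countType) (q : I -> T).
Context (q_dense : forall x e, 0 < e -> exists i, dist x (q i) < e).
Context (r : R) (r1 : 1 <= r) (n : nat) (n0 : (0 < n)%N).
Context (eta : probability T R).
Context (eta_moment : forall x, (\int[eta]_z (dist x z `^ r)%:E < +oo)%E).

Let r0 : 0 < r. Proof. exact: lt_le_trans r1. Qed.

Local Notation F := (@empirical_wasserstein R dT T dist r n eta).
Local Notation cost := (@mean_cost R dT T dist r n).

Let F_le := empirical_wasserstein_le dist_ge0 dist_eq0 distC dist_triangle
  dist_measurable r1 n0 eta_moment.

Lemma mean_cost_le_powR (y y' : 'I_n -> T) e : 0 <= e ->
  (forall i, dist (y i) (y' i) <= e) -> cost y y' <= e `^ r.
Proof.
move=> e0 le_e; rewrite /mean_cost.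
have n0' : 0 < n%:R :> R by rewrite ltr0n.
rewrite mulrC ler_pdivrMr// mulr_natr -[in leRHS](card_ord n) -sumr_const.
by apply: ler_sum => i _; apply: ge0_ler_powR; rewrite ?nnegrE ?(ltW r0).
Qed.

Lemma measurable_empirical_wasserstein :
  measurable_fun setT (F : fun_space T n -> R).
Proof.
(* F y = inf_f g f y, by the Lipschitz bound and density. *)
pose g (f : {ffun 'I_n -> I}) (y : 'I_n -> T) : R :=
  F (q \o f) + cost (q \o f) y `^ r^-1.
have mg f : measurable_fun setT (g f : fun_space T n -> R).
  apply: measurable_funD => //.
  apply: (measurableT_comp (measurable_powR r^-1)).
  apply: measurable_funM => //; apply: measurable_sum => i.
  apply: (measurableT_comp (measurable_powR r)).
  exact: (measurableT_comp dist_measurable (measurable_fun_pair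
    (measurable_cst (q (f i))) (measurable_coordinate i))).
(* In this form a sublevel set of [F] is a union of sublevel sets of the [g f], over the countable
   type of maps from ['I_n] to [I]. *)
have F_lt y c : F y < c <-> exists f, g f y < c.
  split=> [Fc|[f]]; last by apply: le_lt_trans; exact: F_le.
  (* Moving to the dense points costs [e] in [F] and [e] in the root of the mean cost, so
     [g f y <= F y + 2 e < c]. *)
  pose e := (c - F y) / 3.
  have e0 : 0 < e by rewrite divr_gt0// subr_gt0.
  have [f fE] := choice (fun i => q_dense (y i) e0).
  exists (finfun f).
  have cost_e : cost (q \o finfun f) y `^ r^-1 <= e.
    rewrite -[leRHS]powRr1 ?(ltW e0)// -(@divff _ r) ?gt_eqF// powRrM.
    apply: ge0_ler_powR; rewrite ?nnegrE ?powR_ge0 ?invr_ge0 ?(ltW r0)//.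
      by rewrite mean_cost_ge0.
    apply: mean_cost_le_powR => [|i]; first exact: ltW.
    by rewrite /= ffunE distC ltW.
  have Ff_le := F_le y (q \o finfun f).
  rewrite mean_costC// in Ff_le.
  rewrite /g; have -> : c = F y + 3 * e by rewrite /e; field.
  lra.
apply: (measurability _ (RGenInftyO.measurableE R)).
move=> _ [_ [c ->] <-].
rewrite (_ : _ `&` _ = \bigcup_f (setT `&` g f @^-1` `]-oo, c[)).
  by apply: countable_bigcupT_measurable => // f; exact: mg.
apply/seteqP; split=> y /=; rewrite ?in_itv/=.
  by move=> [_ /F_lt[f gc]]; exists f => //; split=> //=; rewrite in_itv.
move=> [f _ [_ /=]]; rewrite in_itv/= => gc; split=> //.
by apply/F_lt; exists f.
Qed.

Lemma wasserstein_iid_le (nu nu' : probability T R)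
    dO (Omega : measurableType dO) (P : probability Omega R)
    (Y : 'I_n -> {RV P >-> T})
    dO' (Omega' : measurableType dO') (P' : probability Omega' R)
    (Y' : 'I_n -> {RV P' >-> T}) :
  iid Y nu -> iid Y' nu' ->
  exists (X : {RV P >-> R}) (X' : {RV P' >-> R}),
    [/\ forall w : Omega,
          (X w)%:E = wasserstein dist r (empirical R (fun i => Y i w)) eta,
        forall w : Omega',
          (X' w)%:E = wasserstein dist r (empirical R (fun i => Y' i w)) eta
      & (wasserstein_real r (distribution P X) (distribution P' X')
         <= wasserstein dist r nu nu')%E].
Proof.
move=> iidY iidY'.
have RV_F dS (S : measurableType dS)
    (V : 'I_n -> S -> T) : (forall i, measurable_fun setT (V i)) ->
    measurable_fun setT (fun w => F (fun i => V i w)).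
  move=> mV; apply: (measurableT_comp measurable_empirical_wasserstein).
  exact: measurable_fun_to_boxes.
have mY i : measurable_fun setT (Y i) by [].
have mY' i : measurable_fun setT (Y' i) by [].
have [X XE] := RV_of_measurable P (RV_F _ _ _ mY).
have [X' X'E] := RV_of_measurable P' (RV_F _ _ _ mY').
exists X, X'; split=> [w|w|].
- by rewrite XE EFin_empirical_wasserstein.
- by rewrite X'E EFin_empirical_wasserstein.
(* Both sides are [r^-1]-th powers of nonnegative infima, so the infima are compared, one coupling
   [pi] of [nu] and [nu'] at a time. *)
apply: gt0_ler_poweR.
- by rewrite invr_ge0 ltW.
- rewrite in_itv/= leey andbT; apply: le_ereal_inf_tmp => _ [p _ <-].
  by apply: integral_ge0 => x _; rewrite lee_fin powR_ge0.
- rewrite in_itv/= leey andbT; apply: le_ereal_inf_tmp => _ [p _ <-].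
  by apply: integral_ge0 => x _; rewrite lee_fin powR_ge0.
apply: le_ereal_inf_tmp => _ [pi cpi <-].
have [dQ [S [Q [Z [mZ QZ]]]]] := iid_family_exists pi n.
have mZ1 i : measurable_fun setT (fun w => (Z i w).1).
  exact: measurableT_comp measurable_fst (mZ i).
have mZ2 i : measurable_fun setT (fun w => (Z i w).2).
  exact: measurableT_comp measurable_snd (mZ i).
have mF1 := RV_F _ _ _ mZ1.
have mF2 := RV_F _ _ _ mZ2.
have [W WE] := RV_of_measurable Q (measurable_fun_pair mF1 mF2).
have mfst (B : set T) : measurable B -> measurable (fst @^-1` B : set (T * T)).
  by move=> mB; rewrite -[X in measurable X]setTI; exact: measurable_fst.
have msnd (B : set T) : measurable B -> measurable (snd @^-1` B : set (T * T)).
  by move=> mB; rewrite -[X in measurable X]setTI; exact: measurable_snd.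
have mFpre (A : set R) : measurable A ->
    measurable (F @^-1` A : set (fun_space T n)).
  move=> mA; rewrite -[X in measurable X]setTI.
  exact: measurable_empirical_wasserstein.
(* The first components of the [Z i] have the joint law of the [Y i], and the second components that
   of the [Y' i]; applying [F] transfers this to the marginals of [W]. *)
have cplW : couplings (distribution P X) (distribution P' X')
    (distribution Q W).
  move=> A mA; split.
    change (Q (W @^-1` (fst @^-1` A)) = P (X @^-1` A)); rewrite WE XE.
    have lawE := joint_law_unique (nu := nu) (P := Q) (P' := P) mZ1 mY _ _
      (mFpre _ mA).
    apply: lawE => B mB.
      rewrite (QZ (fun i => fst @^-1` B i)) => [|i]; last exact: mfst.
      by apply: eq_bigr => i _; have [<- _] := cpi _ (mB i).
    exact: iid_box.
  change (Q (W @^-1` (snd @^-1` A)) = P' (X' @^-1` A)); rewrite WE X'E.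
  have lawE := joint_law_unique (nu := nu') (P := Q) (P' := P') mZ2 mY' _ _
    (mFpre _ mA).
  apply: lawE => B mB.
    rewrite (QZ (fun i => snd @^-1` B i)) => [|i]; last exact: msnd.
    by apply: eq_bigr => i _; have [_ <-] := cpi _ (mB i).
  exact: iid_box.
have mcost2 : measurable_fun setT (fun z : T * T => (dist z.1 z.2 `^ r)%:E).
  by apply/measurable_EFinP; exact: (measurableT_comp (measurable_powR r)).
have Zlaw i : (\int[Q]_w (dist (Z i w).1 (Z i w).2 `^ r)%:E =
               \int[pi]_z (dist z.1 z.2 `^ r)%:E)%E.
  have [m [mE mint]] := pushforward_spec Q (mZ i).
  rewrite -(mint (fun z => (dist z.1 z.2 `^ r)%:E))//; last first.
    by move=> z; rewrite lee_fin powR_ge0.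
  apply: eq_measure_integral => A mA _; rewrite [LHS]mE.
  (* The law of a single [Z i] is read off the joint law on a box whose other sides are the whole
     space. *)
  pose B j := if j == i then A else setT.
  have mB j : measurable (B j) by rewrite /B; case: ifP.
  have := QZ B mB; rewrite (bigD1 i)//= big1 => [|j ji]; last first.
    by rewrite /B (negPf ji) probability_setT.
  rewrite mule1 {2}/B eqxx => <-; congr (Q _).
  apply/seteqP; split=> w /=; last by move=> /(_ i); rewrite /B eqxx.
  by move=> wA j; rewrite /B; case: eqP => // ->.
have mdiff : measurable_fun setT (fun z : R * R => (`|z.1 - z.2| `^ r)%:E).
  apply/measurable_EFinP; apply: (measurableT_comp (measurable_powR r)).
  apply: measurableT_comp => //.
  exact: measurable_funB measurable_fst measurable_snd.
have mZc i : measurable_fun setT (fun w => (dist (Z i w).1 (Z i w).2 `^ r)%:E).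
  exact: (measurableT_comp mcost2 (mZ i)).
suff costW : (\int[distribution Q W]_z (`|z.1 - z.2| `^ r)%:E <=
    \int[pi]_z (dist z.1 z.2 `^ r)%:E)%E.
  by apply: le_trans costW; apply: ereal_inf_lbound; exists (distribution Q W).
rewrite ge0_integral_distribution//.
have ninv0 : 0 <= n%:R^-1 :> R by rewrite invr_ge0.
(* The Lipschitz bound is used pointwise in [w]; by [Zlaw] the average is then one of [n] equal
   terms, each the cost of [pi]. *)
apply: (@le_trans _ _ (\int[Q]_w ((n%:R^-1)%:E *
    \sum_(i < n) (dist (Z i w).1 (Z i w).2 `^ r)%:E))%E).
  apply: ge0_le_integral => //.
  - by move=> w _; rewrite lee_fin powR_ge0.
  - exact: (measurableT_comp mdiff).
  - by apply: measurable_funeM; apply: emeasurable_sum => i.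
  - move=> w _; rewrite /= WE /= sumEFin -EFinM lee_fin.
    exact: empirical_wasserstein_dist_le.
rewrite ge0_integralZl_EFin//; last 2 first.
- by move=> w _; apply: sume_ge0 => i _; rewrite lee_fin powR_ge0.
- by apply: emeasurable_sum => i.
rewrite ge0_integral_sum//; last by move=> i w _; rewrite lee_fin powR_ge0.
rewrite (eq_bigr _ (fun i _ => Zlaw i)).
have cost0 : (0 <= \int[pi]_z (dist z.1 z.2 `^ r)%:E)%E.
  by apply: integral_ge0 => z _; rewrite lee_fin powR_ge0.
rewrite ge0_sume_distrr// -ge0_sume_distrl//.
rewrite sumEFin sumr_const card_ord -[_ *+ n]mulr_natl mulfV ?mul1e//.
by rewrite pnatr_eq0 -lt0n.
Qed.

End SeparableMetric.

(** * Metric properties of the Euclidean norm *)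

Section EuclideanNorm.
Context (R : realType) (d : nat).
Implicit Types x y z : 'rV[R]_d.

Let sum_sqr_ge0 x : 0 <= \sum_(i < d) x 0 i ^+ 2.
Proof. by apply: sumr_ge0 => i _; exact: sqr_ge0. Qed.

Lemma eucl_norm_ge0 x : 0 <= eucl_norm x.
Proof. exact: sqrtr_ge0. Qed.

Lemma eucl_norm_eq0 x : eucl_norm x = 0 <-> x = 0.
Proof.
split=> [/eqP|->]; last first.
  by rewrite /eucl_norm big1 ?sqrtr0// => i _; rewrite mxE expr0n.
rewrite sqrtr_eq0 => x_le0; apply/rowP => i; rewrite mxE.
have : \sum_(i < d) x 0 i ^+ 2 == 0 by rewrite eq_le x_le0 sum_sqr_ge0.
rewrite psumr_eq0 => [/allP/(_ i)|j _]; last exact: sqr_ge0.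
by rewrite mem_index_enum sqrf_eq0 => /(_ isT)/eqP.
Qed.

Lemma eucl_normN x : eucl_norm (- x) = eucl_norm x.
Proof. by congr Num.sqrt; apply: eq_bigr => i _; rewrite mxE sqrrN. Qed.

(** Minkowski's inequality for exponent 2: [powRD_split] is summed over the coordinates and
    [powR_minkowski_split] takes the root. Absolute values make the bases nonnegative. *)
Lemma eucl_normD x y : eucl_norm (x + y) <= eucl_norm x + eucl_norm y.
Proof.
have sqE (u : R) : u ^+ 2 = `|u| `^ 2.
  by rewrite powR_mulrn// real_normK ?num_real.
rewrite /eucl_norm -!powR12_sqrt//; apply: powR_minkowski_split => // [|l l01].
  by rewrite ler1n.
rewrite !mulr_sumr -big_split; apply: ler_sum => i _ /=; rewrite mxE.
rewrite [leLHS]sqE (sqE (x 0 i)) (sqE (y 0 i)).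
apply: le_trans (powRD_split _ l01 _ _) => //; last by rewrite ler1n.
by rewrite ge0_ler_powR ?nnegrE ?addr_ge0 ?ler_normD.
Qed.

Lemma eucl_dist_triangle x y z :
  eucl_norm (x - z) <= eucl_norm (x - y) + eucl_norm (y - z).
Proof. by rewrite -[x - z](subrKA y) eucl_normD. Qed.

Lemma rat_vectors_dense x e : 0 < e ->
  exists v : 'rV[rat]_d, eucl_norm (x - map_mx ratr v) < e.
Proof.
(* Coordinatewise error [c] gives squared norm at most [d c^2], and [d < (d + 1)^2] makes this less
   than [e^2]. *)
move=> e0; pose c := e / d.+1%:R.
have c0 : 0 < c by rewrite divr_gt0.
have near i : exists t : rat, `|x 0 i - ratr t| < c.
  have xc : x 0 i - c < x 0 i + c by rewrite ltrD2l gtrN.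
  have [t] := rat_in_itvoo xc; rewrite in_itv/= => xt.
  by exists t; rewrite distrC ltr_distl.
have [v vE] := choice near; exists (\row_i v i).
rewrite -[ltRHS]ger0_norm ?ltW// -sqrtr_sqr ltr_sqrt ?exprn_gt0//.
apply: (@le_lt_trans _ _ (\sum_(i < d) c ^+ 2)).
  apply: ler_sum => i _; rewrite !mxE -real_normK ?num_real//.
  by apply: lerXn2r; rewrite ?nnegrE ?(ltW c0)//; exact/ltW/vE.
rewrite sumr_const card_ord -mulr_natr /c expr_div_n mulrAC.
rewrite ltr_pdivrMr ?exprn_gt0// ltr_pM2l ?exprn_gt0// -natrX ltr_nat.
by rewrite (leq_trans (ltnSn d))// leq_pmulr.
Qed.

End EuclideanNorm.

(** * Measurability and moments for the Euclidean distance *)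

Section EuclideanMeasurability.
Context (R : realType) (d : nat).

Lemma measurable_coord (i : 'I_d) :
  measurable_fun setT (fun x : vec R d => (x : 'rV[R]_d) 0 i).
Proof.
apply: (measurability _ (RGenOpens.measurableE R)) => _ [_ [a [b ->]] <-].
rewrite setTI; apply: sub_sigma_algebra.
by move/continuousP: (@coord_continuous R 1 d 0 i); apply; exact: interval_open.
Qed.

(** Working with the coordinates of [f] covers differences on [vec R d * vec R d], which carries the
    product sigma-algebra, without comparing it with the Borel one. *)
Lemma measurable_eucl_norm_comp dS (S : measurableType dS)
    (f : S -> 'rV[R]_d) :
  (forall i, measurable_fun setT (fun s => f s 0 i)) ->
  measurable_fun setT (fun s => eucl_norm (f s)).
Proof.
move=> mf.
rewrite (_ : (fun s => _) =
    fun s => (\sum_(i < d) f s 0 i ^+ 2) `^ 2^-1); last first.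
  apply/funext => s; rewrite powR12_sqrt//.
  by apply: sumr_ge0 => i _; exact: sqr_ge0.
apply: (measurableT_comp (measurable_powR _)); apply: measurable_sum => i.
exact: measurable_funX.
Qed.

Lemma measurable_eucl_norm :
  measurable_fun setT (fun x : vec R d => eucl_norm x).
Proof. apply: measurable_eucl_norm_comp => i; exact: measurable_coord. Qed.

Lemma measurable_eucl_dist : measurable_fun setT
  (fun z : vec R d * vec R d => eucl_norm ((z.1 : 'rV[R]_d) - (z.2 : 'rV[R]_d))).
Proof.
apply: measurable_eucl_norm_comp => i.
rewrite (_ : (fun z => _) = (fun z : vec R d * vec R d =>
    (z.1 : 'rV[R]_d) 0 i - (z.2 : 'rV[R]_d) 0 i)); last first.
  by apply/funext => z; rewrite !mxE.
apply: measurable_funB.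
- exact: (measurableT_comp (measurable_coord i) measurable_fst).
- exact: (measurableT_comp (measurable_coord i) measurable_snd).
Qed.

(** [powRD_split] at [l = 1/2] bounds the integrand by a constant plus a multiple of the [r]-th
    power of the norm of [z], both of finite integral under [eta]. *)
Lemma finite_moment_dist (r : R) (eta : probability (vec R d) R)
    (x : vec R d) : 1 <= r -> finite_moment r eta ->
  (\int[eta]_z (eucl_norm ((x : 'rV[R]_d) - (z : 'rV[R]_d)) `^ r)%:E < +oo)%E.
Proof.
move=> r1 heta; have r0 : 0 < r by exact: lt_le_trans r1.
pose a : R := 2^-1 `^ (1 - r); pose b : R := (1 - 2^-1) `^ (1 - r).
have a0 : 0 <= a by exact: powR_ge0.
have b0 : 0 <= b by exact: powR_ge0.
have meta : measurable_fun setT (fun z : vec R d => (eucl_norm z `^ r)%:E).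
  apply/measurable_EFinP.
  exact: (measurableT_comp (measurable_powR r) measurable_eucl_norm).
have mdist : measurable_fun setT (fun z : vec R d =>
    (eucl_norm ((x : 'rV[R]_d) - (z : 'rV[R]_d)) `^ r)%:E).
  apply/measurable_EFinP; apply: (measurableT_comp (measurable_powR r)).
  apply: measurable_eucl_norm_comp => i.
  rewrite (_ : (fun z => _) = (fun z : vec R d =>
      (x : 'rV[R]_d) 0 i - (z : 'rV[R]_d) 0 i)).
    exact: measurable_funB (measurable_cst _) (measurable_coord i).
  by apply/funext => z; rewrite !mxE.
apply: (@le_lt_trans _ _ (\int[eta]_z
    ((a * eucl_norm x `^ r)%:E + b%:E * (eucl_norm z `^ r)%:E))%E).
  apply: ge0_le_integral => //.
  - by move=> z _; rewrite lee_fin powR_ge0.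
  - by apply: emeasurable_funD => //; exact: measurable_funeM.
  - move=> z _; rewrite -EFinM -EFinD lee_fin.
    apply: le_trans (powRD_split r1 _ (eucl_norm_ge0 _) (eucl_norm_ge0 _)).
      apply: ge0_ler_powR; rewrite ?nnegrE ?addr_ge0 ?eucl_norm_ge0 ?(ltW r0)//.
      by rewrite -(eucl_normN z) eucl_normD.
    by rewrite invr_gt0 ltr0n invf_lt1 ?ltr1n.
rewrite ge0_integralD//.
- rewrite integral_cst// ge0_integralZl_EFin//; last first.
    by move=> z _; rewrite lee_fin powR_ge0.
  rewrite lte_add_pinfty// lte_mul_pinfty// ?lee_fin ?mulr_ge0 ?powR_ge0//.
  exact: le_lt_trans (probability_le1 eta measurableT) (ltry 1).
- by move=> z _; rewrite lee_fin mulr_ge0 ?powR_ge0.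
- by move=> z _; rewrite -EFinM lee_fin mulr_ge0 ?powR_ge0.
- exact: measurable_funeM.
Qed.

End EuclideanMeasurability.

(** * Specialisation to Euclidean space, with rational vectors as dense family *)

Theorem theorem1 (R : realType) (d : nat) (hd : (1 <= d)%N)
    (r : R) (hr : 1 <= r)
    (nu nu' eta : probability (vec R d) R)
    (hnu : finite_moment r nu) (hnu' : finite_moment r nu')
    (heta : finite_moment r eta)
    (n : nat) (hn : (1 <= n)%N)
    (dO : measure_display) (Omega : measurableType dO)
    (P : probability Omega R) (Y : 'I_n -> {RV P >-> vec R d})
    (hY : iid Y nu)
    (dO' : measure_display) (Omega' : measurableType dO')
    (P' : probability Omega' R) (Y' : 'I_n -> {RV P' >-> vec R d})
    (hY' : iid Y' nu') :
  exists (X : {RV P >-> R}) (X' : {RV P' >-> R}),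
    [/\ forall w : Omega,
          (X w)%:E = wasserstein_vec r (empirical R (fun i => Y i w)) eta,
        forall w : Omega',
          (X' w)%:E = wasserstein_vec r (empirical R (fun i => Y' i w)) eta
      & (wasserstein_real r (distribution P X) (distribution P' X')
         <= wasserstein_vec r nu nu')%E].
Proof.
pose dist (x y : vec R d) : R := eucl_norm ((x : 'rV[R]_d) - (y : 'rV[R]_d)).
have dist_ge0 x y : 0 <= dist x y by exact: eucl_norm_ge0.
have dist_eq0 x y : dist x y = 0 <-> x = y.
  rewrite /dist eucl_norm_eq0; split=> [/eqP|->]; last by rewrite subrr.
  by rewrite subr_eq0 => /eqP.
have distC x y : dist x y = dist y x by rewrite /dist -eucl_normN opprB.
have dist_triangle x y z : dist x z <= dist x y + dist y z.
  exact: eucl_dist_triangle.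
pose q (v : 'rV[rat]_d) : vec R d := map_mx ratr v.
have q_dense x e : 0 < e -> exists v, dist x (q v) < e.
  exact: rat_vectors_dense.
have moment x : (\int[eta]_z (dist x z `^ r)%:E < +oo)%E.
  exact: finite_moment_dist.
exact: (@wasserstein_iid_le _ _ _ dist dist_ge0 dist_eq0 distC dist_triangle
  (@measurable_eucl_dist R d) _ q q_dense r hr n hn eta moment).
Qed.
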